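(* For every unit interval graph $G$ on $[n]$, $$Y_G\equiv_n\frac{1}{n!}\sum_{D'\in\mathcal A'_L(G)}(-1)^{t(D')}\,e_{\pi(D')}.$$
   Context: Work in $\mathrm{NCSym}$ (symmetric functions in non-commuting variables $x_1,x_2,\dots$ over $\mathbb Q$). For $\pi\vdash[n]$, $e_\pi=\sum x_{i_1}\cdots x_{i_n}$ over tuples with $i_j\ne i_k$ whenever $j\ne k$ are in a common block of $\pi$. For a simple graph $G$ on vertex set $[n]$, $Y_G=\sum_\kappa x_{\kappa(1)}\cdots x_{\kappa(n)}$ over proper colorings $\kappa:[n]\to\{1,2,\dots\}$. A unit interval graph $G$ on $[n]$ is given by intervals $[a_1,1],\dots,[a_n,n]$ with $1\le a_1\le\cdots\le a_n$, $a_k\le k$, with an edge between distinct $i,j$ whenever $i,j\in[a_k,k]$ for some $k$. An arc diagram on $[n]$ is a set of arcs $(i,j)$, $i<j$, with each vertex the right endpoint of at most one arc; $\mathcal A(G)$ is the set of arc diagrams all of whose arcs $(i,j)$ satisfy $i,j\in[a_k,k]$ for some $k$. A tic-marking of $D$ is a choice of subset $T$ of its arcs (carrying tic marks); $t=|T|$. Connected components are those of the graph on $[n]$ with arcs as edges. Pieces: if a component $C$ has tic-marked arcs with right endpoints $j_1<\dots<j_r$, its pieces are $C\cap[1,j_1-1],C\cap[j_1,j_2-1],\dots,C\cap[j_r,n]$; the right-most piece of $C$ is the one containing $\max C$. $\mathcal A'_L(G)$ is the set of all quadruples $D'=(D,T,\delta,S)$ with $D\in\mathcal A(G)$, $T$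 a set of arcs of $D$, $\delta\in\mathfrak S_n$ a labeling ($\delta(i)$ placed on vertex $i$) that is increasing on each piece (if $b_1<\dots<b_k$ are the vertices of a piece then $\delta(b_1)<\dots<\delta(b_k)$), and $S$ a set of starred vertices containing exactly one vertex from the right-most piece of each connected component and no other vertices. $t(D')=|T|$ and $\pi(D')\vdash[n]$ is the set partition into all pieces. Equivalence: $\pi\sim\sigma$ for $\pi,\sigma\vdash[n]$ if they have the same multiset of block sizes and the blocks containing $n$ have equal size; for $f,g$ homogeneous of degree $n$, $f\equiv_n g$ means that for every $\sim$-class the sum of the $e$-coefficients of $f$ over that class equals that of $g$. *)

(* Defs.v *)
From mathcomp Require Import all_boot all_order all_algebra all_fingroup.
Set Implicit Arguments. Unset Strict Implicit. Unset Printing Implicit Defensive.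
Import GRing.Theory.
Local Open Scope ring_scope.

(* Homogeneous degree-n noncommutative formal power series in x_0,x_1,...:
   the coefficient of the word x_{w 0} ... x_{w (n-1)} is f w. *)
Definition series (n : nat) := ('I_n -> nat) -> rat.

Definition setpart (n : nat) (P : {set {set 'I_n}}) : bool :=
  partition P [set: 'I_n].

Definition e_basis (n : nat) (P : {set {set 'I_n}}) : series n :=
  fun w => ([forall j : 'I_n, forall k : 'I_n,
              ((j != k) && (pblock P j == pblock P k)) ==> (w j != w k)] : bool)%:R.

Definition Y_graph (n : nat) (adj : rel 'I_n) : series n :=
  fun w => ([forall i : 'I_n, forall j : 'I_n, adj i j ==> (w i != w j)] : bool)%:R.

Definition ecoeffs (n : nat) (f : series n) (a : {set {set 'I_n}} -> rat) : Prop :=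
  forall w : 'I_n -> nat,
    f w = \sum_(P : {set {set 'I_n}} | setpart P) a P * e_basis P w.

Definition blk_last (n : nat) (P : {set {set 'I_n}}) : nat :=
  (\sum_(B in P | [exists x in B, val x == n.-1]) #|B|)%N.

Definition part_equiv (n : nat) (P Q : {set {set 'I_n}}) : bool :=
  perm_eq [seq #|B| | B : {set 'I_n} <- enum P] [seq #|B| | B : {set 'I_n} <- enum Q]
  && (blk_last P == blk_last Q).

Definition equiv_n (n : nat) (f g : series n) : Prop :=
  (exists a, ecoeffs f a) /\ (exists b, ecoeffs g b) /\
  forall a b, ecoeffs f a -> ecoeffs g b ->
  forall P0 : {set {set 'I_n}}, setpart P0 ->
    \sum_(Q : {set {set 'I_n}} | setpart Q && part_equiv Q P0) a Q =
    \sum_(Q : {set {set 'I_n}} | setpart Q && part_equiv Q P0) b Q.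

(* unit interval graph given by left endpoints a k (0-indexed): interval [a k, k] *)
Definition unit_interval_seq (n : nat) (a : 'I_n -> nat) : Prop :=
  (forall k : 'I_n, (a k <= k)%N) /\
  (forall k l : 'I_n, (k <= l)%N -> (a k <= a l)%N).

Definition in_common_interval (n : nat) (a : 'I_n -> nat) (i j : 'I_n) : bool :=
  [exists k : 'I_n, [&& (a k <= i)%N, (i <= k)%N, (a k <= j)%N & (j <= k)%N]].

Definition uig_adj (n : nat) (a : 'I_n -> nat) : rel 'I_n :=
  fun i j => (i != j) && in_common_interval a i j.

Definition arc_diagram_in (n : nat) (a : 'I_n -> nat) (D : {set 'I_n * 'I_n}) : bool :=
  [forall e in D, (e.1 < e.2)%N && in_common_interval a e.1 e.2] &&
  [forall j : 'I_n, #|[set e in D | e.2 == j]| <= 1]%N.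

Definition arel (n : nat) (D : {set 'I_n * 'I_n}) : rel 'I_n :=
  fun x y => ((x, y) \in D) || ((y, x) \in D).

Definition comp_rel (n : nat) (D : {set 'I_n * 'I_n}) (x y : 'I_n) : bool :=
  connect (arel D) x y.

(* number of tic-marked arcs of the component of y whose right endpoint is <= y *)
Definition cut_key (n : nat) (D T : {set 'I_n * 'I_n}) (y : 'I_n) : nat :=
  #|[set e in T | comp_rel D y e.2 && (e.2 <= y)%N]|.

Definition piece (n : nat) (D T : {set 'I_n * 'I_n}) (x : 'I_n) : {set 'I_n} :=
  [set y | comp_rel D x y && (cut_key D T y == cut_key D T x)].

Definition pieces (n : nat) (D T : {set 'I_n * 'I_n}) : {set {set 'I_n}} :=
  [set piece D T x | x : 'I_n].

Definition rm_piece (n : nat) (D T : {set 'I_n * 'I_n}) (x : 'I_n) : {set 'I_n} :=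
  [set y | [exists z : 'I_n, [&& comp_rel D x z,
             [forall w : 'I_n, comp_rel D x w ==> (w <= z)%N] & y \in piece D T z]]].

Definition AL_prime (n : nat) (a : 'I_n -> nat) (D T : {set 'I_n * 'I_n})
    (d : {perm 'I_n}) (S : {set 'I_n}) : bool :=
  [&& arc_diagram_in a D, T \subset D,
      [forall x : 'I_n, forall y : 'I_n,
         ((y \in piece D T x) && (x < y)%N) ==> (d x < d y)%N],
      [forall x : 'I_n, #|S :&: rm_piece D T x| == 1%N] &
      [forall y in S, y \in rm_piece D T y]].

Definition AL_sum (n : nat) (a : 'I_n -> nat) : series n :=
  fun w => (n`!%:R)^-1 *
    \sum_(D : {set 'I_n * 'I_n}) \sum_(T : {set 'I_n * 'I_n})
      \sum_(d : {perm 'I_n}) \sum_(S : {set 'I_n} | AL_prime a D T d S)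
        (-1) ^+ #|T| * e_basis (pieces D T) w.

(* Main.v *)
Require Import Defs.
From mathcomp Require Import all_boot all_order all_algebra all_fingroup.
Set Implicit Arguments. Unset Strict Implicit. Unset Printing Implicit Defensive.
Import GRing.Theory.
Local Open Scope ring_scope.

(** Multiplying out a product over vertices writes [Y_G] as the signed sum, over
    the arc diagrams [D] of [G], of the indicators [p_D] of the words that are
    constant on the components of [D].  Class sums of e-coefficients only
    depend on the average of a series over the permutations of the positions
    that fix the last one, so it is enough to expand each [p_D] up to averaging.

    Scan the vertices upwards.  Let [k] be a vertex that is not minimal in its
    component, [p] its predecessor there, and [B] the piece of [p] so far.
    Swapping [p] with another element [b] of [B] shows that, up to averaging,
    [e_P [w_k = w_p]] is [1/|B|] times the sum over [b] in [B] of
    [e_P [w_k = w_b]], that is, [1/|B|] times the difference of the two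
    e-functions in which [k] starts a new piece (a tic mark) or joins [B].

    Here [|B|] is the rank [h p] of [p] in its piece.  The product of the
    weights [1/|B|] is therefore the product of [1/h z] over the vertices [z]
    that are not maximal in their component.  Increasing labelings number
    [n!] divided by the product of all [h z], and starrings are counted by the
    product of [h z] over the maxima [z], which gives the coefficient. *)

(** * Expansion over arc diagrams *)

Lemma prod_natr_bool (I : finType) (P b : pred I) :
  \prod_(i | P i) (b i)%:R = ([forall (i | P i), b i] : bool)%:R :> rat.
Proof.
have [/forallP Pb|/forallPn[i]] := boolP [forall (i | P i), b i].
  by rewrite big1 // => i Pi; have := Pb i; rewrite Pi /= => ->.
by rewrite negb_imply => /andP[Pi /negPf bi]; rewrite (bigD1 i) //= bi mul0r.
Qed.

(** The admissible arcs are a parameter [N] because the expansion serves twice: for the edges of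
    [G], and for the pairs inside the blocks of a set partition. *)
Definition arc_diag (n : nat) (N : rel 'I_n) (D : {set 'I_n * 'I_n}) : bool :=
  [forall e in D, N e.1 e.2] &&
  [forall j : 'I_n, #|[set e in D | e.2 == j]| <= 1]%N.

Definition arc_const (n : nat) (D : {set 'I_n * 'I_n}) (w : 'I_n -> nat) : bool :=
  [forall e in D, w e.1 == w e.2].

Lemma arc_diagP (n : nat) (N : rel 'I_n) (D : {set 'I_n * 'I_n}) :
  reflect ((forall i j, (i, j) \in D -> N i j) /\
           (forall i i' j, (i, j) \in D -> (i', j) \in D -> i = i'))
          (arc_diag N D).
Proof.
apply: (iffP andP) => [[/forall_inP HN /forallP H1]|[HN H1]]; split.
- by move=> i j /HN.
- move=> i i' j Di Di'.
  have /card_le1_eqP /(_ (i, j) (i', j)) := H1 j.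
  by rewrite !inE Di Di' eqxx => /(_ isT isT) [].
- by apply/forall_inP => -[i j] /HN.
- apply/forallP=> j; apply/card_le1_eqP=> -[i k] [i' k'].
  rewrite !inE /= => /andP[Di /eqP ek] /andP[Di' /eqP ek']; subst k k'.
  by rewrite (H1 _ _ _ Di Di').
Qed.

(** A proper [w] makes every factor 1. Otherwise take the least [j] with an equally coloured
    [N]-neighbour [i] below it. This [i] is unique, since of two such neighbours the larger would be
    a smaller choice of [j]; hence the factor at [j] is 0. *)
Lemma proper_prodE (n : nat) (N : rel 'I_n) (w : 'I_n -> nat) :
  (forall i j, N i j -> (i < j)%N) ->
  (forall i i' j, N i j -> N i' j -> (i < i')%N -> N i i') ->
  ([forall i : 'I_n, forall j : 'I_n, N i j ==> (w i != w j)] : bool)%:R =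
  \prod_j (1 - \sum_(i | N i j) (w i == w j)%:R) :> rat.
Proof.
move=> N_lt N_int; have [/forallP Hw|] := boolP [forall i, forall j, N i j ==> (w i != w j)].
  rewrite big1 // => j _; rewrite big1 ?subr0 // => i Nij.
  by have /forallP/(_ j) := Hw i; rewrite Nij /= => /negPf->.
move=> /forallPn[i0 /forallPn[j0]]; rewrite negb_imply negbK => Hij0.
pose bad (j : 'I_n) := [exists i, N i j && (w i == w j)].
have bad0 : bad j0 by apply/existsP; exists i0.
case: (arg_minnP (@nat_of_ord n) bad0) => j /existsP[i /andP[Nij wij]] minj.
rewrite (bigD1 j) //= (bigD1 i) //= wij big1 ?addr0 ?subrr ?mul0r // => k /andP[Nkj nki].
case: eqP => // wkj; move: nki; rewrite -val_eqE /= neq_ltn => /orP[lt|lt].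
  have /minj : bad i.
    by apply/existsP; exists k; rewrite (N_int _ _ _ Nkj Nij lt) wkj eq_sym.
  by rewrite leqNgt N_lt.
have /minj : bad k.
  by apply/existsP; exists i; rewrite (N_int _ _ _ Nij Nkj lt) wkj.
by rewrite leqNgt N_lt.
Qed.

(** Multiplying out, one picks at each [j] either the term 1 or a single arc into [j]; such a family
    of choices is exactly an arc diagram. *)
Lemma arc_expansion (n : nat) (N : rel 'I_n) (w : 'I_n -> nat) :
  (forall i j, N i j -> (i < j)%N) ->
  (forall i i' j, N i j -> N i' j -> (i < i')%N -> N i i') ->
  ([forall i : 'I_n, forall j : 'I_n, N i j ==> (w i != w j)] : bool)%:R =
  \sum_(D | arc_diag N D) (-1) ^+ #|D| * (arc_const D w)%:R :> rat.
Proof.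
move=> N_lt N_int; rewrite proper_prodE //.
(* [None] stands for the term 1, [Some i] for the arc from [i] to [j]. *)
pose Q (j : 'I_n) (o : option 'I_n) := if o is Some i then N i j else true.
pose F (j : 'I_n) (o : option 'I_n) : rat :=
  if o is Some i then - (w i == w j)%:R else 1.
transitivity (\prod_j \sum_(o | Q j o) F j o).
  apply: eq_bigr => j _; rewrite (bigD1 None) //=; congr (_ + _).
  rewrite -sumrN (reindex_onto Some (fun o => odflt j o)) /=; last by case.
  by apply: eq_bigl => i; rewrite eqxx !andbT.
rewrite bigA_distr_big_dep.
pose dia (f : {ffun 'I_n -> option 'I_n}) := [set e : 'I_n * 'I_n | f e.2 == Some e.1].
pose fam (D : {set 'I_n * 'I_n}) := [ffun j => [pick i | (i, j) \in D]].
rewrite (reindex_onto dia fam) /=; last first.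
  move=> D /arc_diagP[_ D1]; apply/setP=> -[i j]; rewrite inE ffunE /=.
  case: pickP => [i' Di'|/(_ i) ->//]; apply/eqP/idP => [[<-]//|Di].
  by congr Some; apply: D1 Di' Di.
apply: eq_big => [f|f _]; last first.
  transitivity (\prod_(e in dia f) - ((w e.1 == w e.2)%:R : rat)); last first.
    by rewrite prodrN prod_natr_bool.
  (* Grouped by right endpoint, the arcs leave at most one per vertex, the one chosen by [f]. *)
  rewrite (partition_big (fun e => e.2) predT) //=; apply: eq_bigr => j _.
  rewrite /F; case Ef: (f j) => [i|].
    rewrite (big_pred1 (i, j)) // => -[i' j'] /=; rewrite inE /= xpair_eqE /= andbC.
    by case: eqP => [->|]; rewrite ?andbF // Ef andbT /= eq_sym.
  rewrite big_pred0 // => -[i' j'] /=; rewrite inE /= andbC.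
  by case: eqP => // ->; rewrite Ef.
apply/idP/andP => [/familyP Hf|[/arc_diagP[HN _] _]].
  split.
    apply/arc_diagP; split=> [i j|i i' j]; rewrite !inE /=.
      by move=> /eqP Ef; have := Hf j; rewrite unfold_in Ef.
    by move=> /eqP -> /eqP [].
  apply/eqP/ffunP => j; rewrite ffunE; case: pickP => [i|]; first by rewrite inE => /eqP->.
  by case Ef: (f j) => [i|] // /(_ i); rewrite inE /= Ef eqxx.
apply/familyP => j; rewrite unfold_in /Q; case Ef: (f j) => [i|] //.
by apply: HN; rewrite inE /= Ef.
Qed.

(** * Components of an arc diagram *)

Section Components.
Variables (n : nat) (D : {set 'I_n * 'I_n}).

Lemma comp_refl x : comp_rel D x x.
Proof. exact: connect0. Qed.

Lemma comp_sym x y : comp_rel D x y = comp_rel D y x.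
Proof. by apply: sym_connect_sym => u v; rewrite /arel orbC. Qed.

Lemma comp_trans x y z : comp_rel D x y -> comp_rel D y z -> comp_rel D x z.
Proof. exact: connect_trans. Qed.

Lemma comp_arc x y : (x, y) \in D -> comp_rel D x y.
Proof. by move=> Dxy; apply: connect1; rewrite /arel Dxy. Qed.

Lemma comp_congr x y z : comp_rel D x y -> comp_rel D x z = comp_rel D y z.
Proof.
move=> Rxy; apply/idP/idP; last exact: comp_trans.
by apply: comp_trans; rewrite comp_sym.
Qed.

Lemma arc_constP (w : 'I_n -> nat) :
  reflect (forall x y, comp_rel D x y -> w x = w y) (arc_const D w).
Proof.
apply: (iffP forall_inP) => [Hw x y /connectP[p]|Hw e De]; last first.
  by apply/eqP/Hw/comp_arc; rewrite -surjective_pairing.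
elim: p x => [|z p IH] x /=; first by move=> _ ->.
move=> /andP[/orP xz zp] ey; rewrite -(IH z zp ey).
by case: xz => /Hw /= /eqP.
Qed.

Definition nonmin (y : 'I_n) : bool := [exists x : 'I_n, (x < y)%N && comp_rel D x y].

(** The predecessor is taken in the vertex order of the component, not along an arc. The default [y]
    is reached only at component minima; uses are guarded by [nonmin]. *)
Definition comp_prev (y : 'I_n) : 'I_n :=
  odflt y [pick x : 'I_n | [&& (x < y)%N, comp_rel D x y &
     [forall z : 'I_n, (z < y)%N && comp_rel D z y ==> (z <= x)%N]]].

Lemma comp_prevP (y : 'I_n) : nonmin y ->
  [/\ (comp_prev y < y)%N, comp_rel D (comp_prev y) y &
      forall z : 'I_n, (z < y)%N -> comp_rel D z y -> (z <= comp_prev y)%N].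
Proof.
move=> /existsP[x Hx]; rewrite /comp_prev.
case: pickP => [u /and3P[-> -> /forallP H]|H] /=.
  by split=> // z zy Rzy; have := H z; rewrite zy Rzy.
pose P (x : 'I_n) := (x < y)%N && comp_rel D x y; have Px : P x by [].
case: (arg_maxnP (@nat_of_ord n) Px) => u Hu maxu.
have /and3P := H u; case; case/andP: Hu => -> ->; split=> //.
by apply/forallP => z; apply/implyP => /maxu.
Qed.

(* In an arc diagram, the vertices from which one can walk down the arcs to a vertex
   without incoming arc form a whole component. *)
Lemma nonminE (N : rel 'I_n) (y : 'I_n) : (forall i j, N i j -> (i < j)%N) ->
  arc_diag N D -> nonmin y = [exists e in D, e.2 == y].
Proof.
move=> N_lt /arc_diagP[HN H1]; apply/idP/existsP => [|[[i j] /= /andP[Dij /eqP <-]]]; last first.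
  by apply/existsP; exists i; rewrite (N_lt _ _ (HN _ _ Dij)) comp_arc.
move=> /existsP[x /andP[xy Rxy]]; apply/existsP; apply: contraTT xy => /existsPn Hy.
pose down : rel 'I_n := fun u v => (v, u) \in D.
have down_le u v : connect down u v -> (v <= u)%N.
  move=> /connectP[p]; elim: p u => [|z p IH] u /=; first by move=> _ ->.
  move=> /andP[uz zp] /(IH _ zp) vz; apply: leq_trans vz (ltnW _).
  exact: N_lt (HN _ _ uz).
suff : connect down x y by move=> /down_le; rewrite leqNgt.
move: Rxy; rewrite comp_sym => /connectP[p pP ->] {x}.
have: connect down y y by apply: connect0.
(* Invariant: the current vertex of the path walks down to [y]. An arc taken upwards prolongs this
   walk; an arc taken downwards is its first step, as a vertex has at most one incoming arc. *)
elim: p {1 2 4}y pP => //= z p IH u /andP[uz zp] uy; apply: IH zp _.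
case/orP: uz => uz; first exact: (connect_trans (connect1 (uz : down z u)) uy).
have [q] := connectP uy; case: q => [|v q] /=.
  by move=> _ yu; have := Hy (z, u); rewrite uz /= yu eqxx.
move=> /andP[uv vq] ->; have -> : z = v by apply: H1 uz uv.
by apply/connectP; exists q.
Qed.

(** Each vertex that is not a component minimum is the right endpoint of exactly one arc, so the
    sign of a diagram depends only on its components. *)
Lemma card_arc_diag (N : rel 'I_n) : (forall i j, N i j -> (i < j)%N) ->
  arc_diag N D -> #|D| = #|[set y | nonmin y]|.
Proof.
move=> N_lt HD; have /arc_diagP[_ H1] := HD.
have -> : [set y | nonmin y] = (fun e => e.2) @: D.
  apply/setP => y; rewrite inE (nonminE y N_lt HD).
  apply/existsP/imsetP => [[e /andP[De /eqP <-]]|[e De ->]]; exists e => //.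
  by rewrite De eqxx.
rewrite card_in_imset // => -[i j] [i' j'] Di Di' /= ej; subst j'.
by rewrite (H1 _ _ _ Di Di').
Qed.

End Components.

(** * Averaging over permutations fixing the last position *)

(** A condition on values makes sense for [n = 0] too, where there is no last position. *)
Definition fixes_last (n : nat) (s : {perm 'I_n}) : bool :=
  [forall x : 'I_n, (val x == n.-1) ==> (s x == x)].

(* Summing over these permutations turns the relation [equiv_n] into an equality of
   series (one implication is [symeq_part_equiv]). *)
Definition symeq (n : nat) (f g : series n) : Prop :=
  forall w : 'I_n -> nat,
    \sum_(s : {perm 'I_n} | fixes_last s) f (fun x => w (s x)) =
    \sum_(s : {perm 'I_n} | fixes_last s) g (fun x => w (s x)).

Section SymEq.
Variable n : nat.
Implicit Types f g h : series n.

Lemma fixes_lastM (s t : {perm 'I_n}) :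
  fixes_last s -> fixes_last (s * t)%g = fixes_last t.
Proof.
move=> /forallP Hs; apply: eq_forallb => x; case: eqP => //= ex.
by have /implyP/(_ (introT eqP ex))/eqP sx := Hs x; rewrite permM sx.
Qed.

Lemma eq_symeq f g : f =1 g -> symeq f g.
Proof. by move=> fg w; apply: eq_bigr => s _; rewrite fg. Qed.

Lemma symeq_trans g f h : symeq f g -> symeq g h -> symeq f h.
Proof. by move=> fg gh w; rewrite fg gh. Qed.

(** Translation by [s] permutes the summands. Stating the hypothesis for pointwise equal words
    avoids function extensionality. *)
Lemma symeq_perm (s : {perm 'I_n}) f g : fixes_last s ->
  (forall w w' : 'I_n -> nat, (forall x, w' x = w (s x)) -> f w' = g w) ->
  symeq f g.
Proof.
move=> Hs fg w; rewrite (reindex_inj (mulgI s)) /=.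
by apply: eq_big => t; [rewrite fixes_lastM | move=> _; apply: fg => x; rewrite permM].
Qed.

Lemma symeq_scale (c : rat) f g : symeq f g ->
  symeq (fun w => c * f w) (fun w => c * g w).
Proof. by move=> fg w; rewrite -!mulr_sumr fg. Qed.

Lemma symeq_sum (I : finType) (P : pred I) (f g : I -> series n) :
  (forall i, P i -> symeq (f i) (g i)) ->
  symeq (fun w => \sum_(i | P i) f i w) (fun w => \sum_(i | P i) g i w).
Proof.
move=> fg w; rewrite exchange_big [RHS]exchange_big /=.
by apply: eq_bigr => i /fg.
Qed.

End SymEq.

(** Pairs the tic-markings without and with the arc [e]. *)
Lemma sum_subset_setU1 (I : finType) (e : I) (A : {set I}) (f : {set I} -> rat) :
  e \notin A ->
  \sum_(X : {set I} | X \subset e |: A) f X =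
  \sum_(X : {set I} | X \subset A) (f X + f (e |: X)).
Proof.
move=> eA; rewrite (bigID (fun X : {set I} => e \in X)) /= big_split addrC /=.
congr (_ + _).
  apply: eq_bigl => X; apply/andP/idP => [[sX eX]|sX].
    by rewrite -(setU1K eA) subsetD1 sX.
  by rewrite (subset_trans sX) ?subsetU1 //; split=> //; apply: contra eA; apply: subsetP.
rewrite (reindex_onto (fun X => e |: X) (fun X => X :\ e)) /=; last first.
  by move=> X /andP[_ eX]; rewrite setD1K.
apply: eq_bigl => X; rewrite setU11 andbT; apply/andP/idP => [[sX /eqP eX]|sX].
  by rewrite -eX -(setU1K eA) setSD.
rewrite setUS // setU1K //; apply: contra eA; exact: subsetP.
Qed.

(** * Cutting components into pieces *)

Section Pieces.
Variables (n : nat) (D : {set 'I_n * 'I_n}).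
Implicit Types T : {set 'I_n * 'I_n}.

Lemma mem_piece T x y : (y \in piece D T x) =
  comp_rel D x y && (cut_key D T y == cut_key D T x).
Proof. by rewrite inE. Qed.

Lemma piece_refl T x : x \in piece D T x.
Proof. by rewrite mem_piece comp_refl eqxx. Qed.

Lemma piece_sym T x y : (y \in piece D T x) = (x \in piece D T y).
Proof. by rewrite !mem_piece comp_sym eq_sym. Qed.

Lemma piece_congr T x y z : y \in piece D T x -> (z \in piece D T x) = (z \in piece D T y).
Proof. by rewrite !mem_piece => /andP[/comp_congr-> /eqP->]. Qed.

Lemma cut_key_agree T T' (y : 'I_n) :
  (forall e : 'I_n * 'I_n, (e.2 <= y)%N -> (e \in T) = (e \in T')) ->
  cut_key D T y = cut_key D T' y.
Proof.
move=> H; apply: eq_card => e; rewrite !inE.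
by case: (leqP e.2 y) => [/H->//|]; rewrite !andbF.
Qed.

Lemma cut_key_mono T (x y : 'I_n) :
  comp_rel D x y -> (x <= y)%N -> (cut_key D T x <= cut_key D T y)%N.
Proof.
move=> Rxy lexy; apply/subset_leq_card/subsetP => e; rewrite !inE (comp_congr _ Rxy).
by case/and3P => -> -> /leq_trans->.
Qed.

(** No vertex of the component lies strictly between [y] and its predecessor, so only a tic at [y]
    itself could separate their keys. *)
Lemma cut_key_prev T (y : 'I_n) : nonmin D y ->
  (forall e, e \in T -> e.2 != y) -> cut_key D T y = cut_key D T (comp_prev D y).
Proof.
move=> /comp_prevP[py Rpy Hp] HT; apply: eq_card => e; rewrite !inE (comp_congr _ Rpy).
case eT: (e \in T) => //=; case Re: (comp_rel D y e.2) => //=.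
apply/idP/idP => [ey|ep]; last by rewrite ltnW // (leq_ltn_trans ep).
by apply: Hp; [rewrite ltn_neqAle ey andbT; apply: HT | rewrite comp_sym].
Qed.

Lemma cut_key_cut T e : e \notin T -> cut_key D (e |: T) e.2 = (cut_key D T e.2).+1.
Proof.
move=> eT; rewrite /cut_key.
have -> : [set e' in e |: T | comp_rel D e.2 e'.2 && (e'.2 <= e.2)%N] =
    e |: [set e' in T | comp_rel D e.2 e'.2 && (e'.2 <= e.2)%N].
  apply/setP => e'; rewrite !inE; case: eqP => //= ->.
  by rewrite comp_refl leqnn.
by rewrite cardsU1 inE (negPf eT).
Qed.

(** The rank of [z] from the left in its piece. Tics to the right of [z] do not affect it, so it
    stays the same as the scan goes on. *)
Definition height T (z : 'I_n) : nat := #|[set x in piece D T z | (x <= z)%N]|.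

Lemma height_gt0 T z : (0 < height T z)%N.
Proof. by apply/card_gt0P; exists z; rewrite inE piece_refl leqnn. Qed.

Lemma height_agree T T' (z : 'I_n) :
  (forall e : 'I_n * 'I_n, (e.2 <= z)%N -> (e \in T) = (e \in T')) -> height T z = height T' z.
Proof.
move=> H; apply: eq_card => x; rewrite !inE; case: (leqP x z) => xz; last by rewrite !andbF.
rewrite (cut_key_agree H) (@cut_key_agree T T' x) // => e ex.
by apply: H; apply: leq_trans xz.
Qed.

(** * Series interpolating between the power sum of a diagram and its e-expansion *)

Definition distinct_below (k : nat) T (w : 'I_n -> nat) : bool :=
  [forall x : 'I_n, forall y : 'I_n,
    [&& (x < k)%N, (y < k)%N, x != y & y \in piece D T x] ==> (w x != w y)].

Definition linked_above (k : nat) (w : 'I_n -> nat) : bool :=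
  [forall y : 'I_n, nonmin D y && (k <= y)%N ==> (w (comp_prev D y) == w y)].

(** One factor per scanned vertex having a predecessor. At [k = n] the minus signs cancel the sign
    of the diagram. *)
Definition coef (k : nat) T : rat :=
  \prod_(y : 'I_n | nonmin D y && (y < k)%N) - (height T (comp_prev D y))%:R^-1.

Definition arcs_below (k : nat) := [set e in D | (e.2 < k)%N].

(* Interpolates between [p_D] at [k = 0] and the expansion over all tic-markings at [k =
   n]; the vertices below [k] have already been scanned. *)
Definition hybrid (k : nat) (w : 'I_n -> nat) : rat :=
  \sum_(T : {set 'I_n * 'I_n} | T \subset arcs_below k)
     (-1) ^+ #|T| * (coef k T * (distinct_below k T w && linked_above k w)%:R).

Lemma distinct_belowP k T w :
  reflect (forall x y : 'I_n, (x < k)%N -> (y < k)%N -> x != y -> y \in piece D T x -> w x != w y)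
          (distinct_below k T w).
Proof.
apply: (iffP forallP) => [H x y xk yk nxy xy|H x].
  by have /forallP/(_ y) := H x; rewrite xk yk nxy xy.
by apply/forallP => y; apply/implyP => /and4P[]; apply: H.
Qed.

Lemma linked_aboveP k w :
  reflect (forall y : 'I_n, nonmin D y -> (k <= y)%N -> w (comp_prev D y) = w y) (linked_above k w).
Proof.
apply: (iffP forallP) => [H y My ky|H y].
  by have := H y; rewrite My ky => /eqP.
by apply/implyP => /andP[My /(H _ My)->].
Qed.

Lemma linked_aboveS (k : 'I_n) w :
  linked_above k w = (nonmin D k ==> (w (comp_prev D k) == w k)) && linked_above k.+1 w.
Proof.
apply/linked_aboveP/andP => [H|[Hk /linked_aboveP H] y My].
  split; first by apply/implyP => Mk; rewrite H.
  by apply/linked_aboveP => y My /ltnW; apply: H.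
rewrite leq_eqVlt => /orP[/eqP/ord_inj ky|]; last exact: H.
by subst y; apply/eqP; move: Hk; rewrite My.
Qed.

(** A component minimum has no incoming arc and no predecessor, and shares its piece with no smaller
    vertex, so scanning it changes nothing. *)
Lemma hybrid_min (k : 'I_n) w : (forall e, e \in D -> e.2 != k) -> ~~ nonmin D k ->
  hybrid k w = hybrid k.+1 w.
Proof.
move=> Dk Mk; rewrite /hybrid.
have -> : arcs_below k.+1 = arcs_below k.
  apply/setP => e; rewrite !inE ltnS leq_eqVlt; case De: (e \in D) => //=.
  by rewrite val_eqE (negPf (Dk _ De)).
apply: eq_bigr => T _; congr (_ * (_ * _%:R)).
  apply: eq_bigl => y; rewrite ltnS [in RHS]leq_eqVlt; have [/ord_inj->|//] := eqVneq (y : nat) k.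
  by rewrite (negPf Mk).
rewrite linked_aboveS (negPf Mk) /=; congr (nat_of_bool (_ && _)).
have kmin (x : 'I_n) : (x < k)%N -> comp_rel D x k -> false.
  by move=> xk Rxk; apply: contraNT Mk => _; apply/existsP; exists x; rewrite xk.
apply/distinct_belowP/distinct_belowP => H x y; last by move=> xk yk; apply: H; apply: ltnW.
rewrite !ltnS leq_eqVlt => /orP[/eqP/ord_inj ->|xk]; rewrite leq_eqVlt => /orP[/eqP/ord_inj ->|yk].
- by rewrite eqxx.
- by rewrite mem_piece comp_sym => _ /andP[/(kmin _ yk)].
- by rewrite mem_piece => _ /andP[/(kmin _ xk)].
- exact: H.
Qed.

(** * Scanning a vertex that is not minimal in its component *)

Section Step.
Variables (k : 'I_n) (e : 'I_n * 'I_n) (T : {set 'I_n * 'I_n}).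
Hypotheses (Mk : nonmin D k) (ek : e.2 = k) (Tk : T \subset arcs_below k).
Let p := comp_prev D k.
Let B := [set x in piece D T p | (x <= p)%N].

Let T_lt f : f \in T -> (f.2 < k)%N.
Proof. by move=> /(subsetP Tk); rewrite inE => /andP[]. Qed.

Let agree (x : 'I_n) : (x < k)%N -> forall f : 'I_n * 'I_n, (f.2 <= x)%N -> (f \in T) = (f \in e |: T).
Proof.
move=> xk f fx; rewrite !inE; case: eqP => //= fe; move: xk.
by rewrite -ek -fe ltnNge fx.
Qed.

Let eNT : e \notin T.
Proof. by apply/negP => /T_lt; rewrite ek ltnn. Qed.

Let key_k : cut_key D T k = cut_key D T p.
Proof. by apply: cut_key_prev => // f /T_lt; apply: contraTneq => ->; rewrite ltnn. Qed.

Lemma coefS : coef k.+1 T = coef k T * - (height T p)%:R^-1.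
Proof.
rewrite /coef (bigD1 k) /= ?Mk ?ltnSn // mulrC; congr (_ * _).
apply: eq_bigl => y; rewrite ltnS leq_eqVlt -val_eqE /=.
case: (ltngtP y k) => /=; rewrite ?andbF ?andbT // => _.
Qed.

(** Only heights of predecessors occur; these lie strictly below [k], where a tic at [k] is
    invisible. *)
Lemma coef_cut : coef k.+1 (e |: T) = coef k.+1 T.
Proof.
apply: eq_bigr => y /andP[/comp_prevP[py _ _] yk]; rewrite (@height_agree T (e |: T)) //.
by apply: agree; apply: leq_trans py _.
Qed.

Lemma mem_blockB (x : 'I_n) : (x < k)%N -> (x \in piece D T k) = (x \in B).
Proof.
have [pk Rpk Hp] := comp_prevP Mk.
move=> xk; rewrite mem_piece [in RHS]inE mem_piece key_k (comp_congr _ Rpk).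
case Rkx: (comp_rel D k x) => //=; rewrite Hp ?andbT //.
by rewrite comp_sym.
Qed.

(** The tic raises the key of [k] above all earlier keys of its component, so [k] opens a new piece
    and adds no condition. *)
Lemma distinct_below_cut w : distinct_below k.+1 (e |: T) w = distinct_below k T w.
Proof.
have key_lt (x : 'I_n) : (x < k)%N -> cut_key D (e |: T) x = cut_key D T x.
  by move=> xk; apply/esym/cut_key_agree/agree.
have Nk (x : 'I_n) : (x < k)%N -> x \in piece D (e |: T) k -> false.
  have [pk Rpk Hp] := comp_prevP Mk.
  move=> xk; rewrite mem_piece key_lt // => /andP[Rkx].
  rewrite -{1}ek cut_key_cut // ek key_k => /eqP ekey.
  suff : (cut_key D T x <= cut_key D T p)%N by rewrite ekey ltnn.
  apply: cut_key_mono; last by rewrite Hp // comp_sym.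
  by rewrite comp_sym (comp_congr _ Rpk).
apply/distinct_belowP/distinct_belowP => H x y.
  move=> xk yk nxy; rewrite mem_piece -!key_lt // -mem_piece.
  by apply: H => //; apply: ltnW.
rewrite !ltnS leq_eqVlt => /orP[/eqP/ord_inj ->|xk]; rewrite leq_eqVlt => /orP[/eqP/ord_inj ->|yk].
- by rewrite eqxx.
- by move=> _ /(Nk _ yk).
- by rewrite piece_sym => _ /(Nk _ xk).
- by rewrite mem_piece !key_lt // -mem_piece; apply: H.
Qed.

Lemma distinct_belowS w :
  distinct_below k.+1 T w = distinct_below k T w && [forall x in B, w x != w k].
Proof.
have [pk Rpk Hp] := comp_prevP Mk.
apply/distinct_belowP/andP => [H|[/distinct_belowP H /forall_inP HB] x y].
  split; first by apply/distinct_belowP => x y xk yk; apply: H; apply: ltnW.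
  apply/forall_inP => x xB.
  have xk : (x < k)%N by move: xB; rewrite inE => /andP[_ xp]; apply: leq_ltn_trans pk.
  apply: H; rewrite ?ltnS ?(ltnW xk) //; last by rewrite piece_sym mem_blockB.
  by rewrite -val_eqE /= ltn_eqF.
rewrite !ltnS leq_eqVlt => /orP[/eqP/ord_inj ->|xk]; rewrite leq_eqVlt => /orP[/eqP/ord_inj ->|yk].
- by rewrite eqxx.
- by move=> _; rewrite mem_blockB // eq_sym; apply: HB.
- by move=> _; rewrite piece_sym mem_blockB //; apply: HB.
- exact: H.
Qed.

(** The vertices of [B] have distinct colours, so at most one of them shares the colour of [k]. *)
Lemma distinct_below_collision w : distinct_below k T w ->
  1 - ([forall x in B, w x != w k] : bool)%:R = \sum_(b in B) (w b == w k)%:R :> rat.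
Proof.
have [pk _ _] := comp_prevP Mk.
move=> /distinct_belowP Hw; have [/forall_inP H|] := boolP [forall x in B, w x != w k].
  by rewrite subrr big1 // => b /H /negPf->.
move=> /forall_inPn[b bB]; rewrite negbK => /eqP wb.
rewrite subr0 (bigD1 b) //= wb eqxx big1 ?addr0 // => c /andP[cB ncb].
case: eqP => // wc; have : w b != w c.
  move: bB cB; rewrite !inE -!mem_piece => /andP[bp lb] /andP[cp lc].
  apply: Hw; rewrite ?(leq_ltn_trans _ pk) 1?eq_sym //.
  by rewrite -(piece_congr _ bp).
by rewrite wb wc eqxx.
Qed.

(** The transposition of [b] and [p] moves only vertices below [k], hence fixes the last position.
    It preserves pieces and leaves the conditions above [k] untouched. *)
Lemma swap_symeq b : b \in B ->
  symeq (fun w => (distinct_below k T w && ((w p == w k) && linked_above k.+1 w))%:R)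
        (fun w => (distinct_below k T w && ((w b == w k) && linked_above k.+1 w))%:R).
Proof.
have [pk Rpk Hp] := comp_prevP Mk.
move=> bB; have lbp : (b <= p)%N by move: bB; rewrite inE => /andP[].
have bp : b \in piece D T p by move: bB; rewrite inE => /andP[].
have Rpb : comp_rel D p b by move: bp; rewrite mem_piece => /andP[].
have bk : (b < k)%N by apply: leq_ltn_trans pk.
set s := tperm b p.
have s_lt (x : 'I_n) : (s x < k)%N = (x < k)%N by rewrite /s; case: tpermP => [->|->|//]; rewrite bk pk.
have s_ge (x : 'I_n) : (k <= x)%N -> s x = x.
  by move=> kx; rewrite /s tpermD // -val_eqE /= ltn_eqF // (leq_trans _ kx).
have s_piece x : s x \in piece D T x.
  by rewrite /s; case: tpermP => [->|->|_ _]; rewrite // ?piece_refl // piece_sym.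
(* For [y] beyond [k], the predecessor is at least [k] if [y] is in the component of [k], and lies
   in another component otherwise; it is neither [b] nor [p]. *)
have s_prev (y : 'I_n) : nonmin D y -> (k < y)%N -> s (comp_prev D y) = comp_prev D y.
  move=> /comp_prevP[py Ry Hy] ky.
  have nk (x : 'I_n) : comp_rel D x k -> (x < k)%N -> comp_prev D y != x.
    move=> Rxk xk; apply/eqP => ex; move: Ry; rewrite ex => Rxy.
    have := Hy k ky; rewrite comp_sym -(comp_congr _ Rxy) => /(_ Rxk).
    by rewrite ex leqNgt xk.
  rewrite /s tpermD // eq_sym nk //.
  by rewrite -(comp_congr _ Rpb).
apply: (@symeq_perm _ s) => [|w w' ww'].
  apply/forallP => x; apply/implyP => /eqP xn; rewrite s_ge // xn.
  by rewrite -ltnS (ltn_predK (ltn_ord k)).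
have ed : distinct_below k T w' = distinct_below k T w.
  apply/distinct_belowP/distinct_belowP => H x y xk yk nxy xy.
    have := H (s x) (s y); rewrite !ww' !tpermK !s_lt => -> //.
      by rewrite (inj_eq perm_inj).
    by rewrite -(piece_congr _ (s_piece x)) (piece_congr _ xy).
  rewrite !ww'; apply: H; rewrite ?s_lt ?(inj_eq perm_inj) //.
  by rewrite -(piece_congr _ (s_piece x)) (piece_congr _ xy).
have el : linked_above k.+1 w' = linked_above k.+1 w.
  apply/linked_aboveP/linked_aboveP => H y My ky; have := H y My ky.
    by rewrite !ww' s_prev // s_ge // ltnW.
  by rewrite !ww' s_prev // s_ge // ltnW.
by rewrite ed el !ww' (s_ge k) // /s tpermR.
Qed.

Lemma step_symeq :
  symeq (fun w => coef k T * (distinct_below k T w && linked_above k w)%:R)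
        (fun w => coef k.+1 T * (distinct_below k.+1 T w && linked_above k.+1 w)%:R
           - coef k.+1 (e |: T) * (distinct_below k.+1 (e |: T) w && linked_above k.+1 w)%:R).
Proof.
pose g b w := (distinct_below k T w && ((w b == w k) && linked_above k.+1 w))%:R : rat.
have hB : (height T p)%:R = (#|B|)%:R :> rat by [].
have h0 : (height T p)%:R != 0 :> rat by rewrite Num.Theory.pnatr_eq0 -lt0n height_gt0.
(* The term is spread over [#|B|] equal copies, so that each can be swapped towards a different
   [b]. *)
apply: (@symeq_trans _ (fun w => \sum_(b in B) (coef k T / (height T p)%:R) * g p w)).
  apply: eq_symeq => w; rewrite sumr_const -[RHS]mulr_natr -hB mulrAC divfK //.
  by rewrite linked_aboveS Mk.
apply: (@symeq_trans _ (fun w => \sum_(b in B) (coef k T / (height T p)%:R) * g b w)).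
  by apply: symeq_sum => b bB; apply: symeq_scale; apply: swap_symeq.
apply: eq_symeq => w; rewrite coef_cut coefS distinct_below_cut distinct_belowS.
rewrite -mulr_sumr mulrN !mulNr opprK addrC -mulrBr /g.
congr (_ * _); case Hd: (distinct_below k T w) => /=; last by rewrite big1 ?subrr.
case: (linked_above _ w) => /=; last first.
  by rewrite andbF big1 ?subrr // => b _; rewrite andbF.
rewrite andbT distinct_below_collision //.
by apply: eq_bigr => b _; rewrite andbT.
Qed.

End Step.

Lemma hybrid_step (N : rel 'I_n) (k : 'I_n) : (forall i j, N i j -> (i < j)%N) ->
  arc_diag N D -> symeq (hybrid k) (hybrid k.+1).
Proof.
move=> N_lt HD; have [Mk|Mk] := boolP (nonmin D k); last first.
  apply: eq_symeq => w; apply: hybrid_min => //.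
  by move: Mk; rewrite (nonminE _ N_lt HD) => /exists_inPn.
have := Mk; rewrite (nonminE _ N_lt HD) => /exists_inP[e De /eqP ek].
have /arc_diagP[_ H1] := HD.
have eN : e \notin arcs_below k by rewrite inE ek ltnn andbF.
have -> : hybrid k.+1 = fun w => \sum_(T : {set 'I_n * 'I_n} | T \subset arcs_below k.+1)
     (-1) ^+ #|T| * (coef k.+1 T * (distinct_below k.+1 T w && linked_above k.+1 w)%:R) by [].
(* Only one arc ends at [k], so the scan offers a single new tic. *)
have -> : arcs_below k.+1 = e |: arcs_below k.
  apply/setP => f; rewrite !inE ltnS leq_eqVlt andb_orr; congr (_ || _).
  apply/andP/eqP => [[Df /eqP/ord_inj fk]|->]; last by rewrite De ek.
  case: e f De Df ek fk {eN} => i j [i' j'] /= De Df ek fk; subst j j'.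
  by rewrite (H1 _ _ _ De Df).
apply: (symeq_trans (symeq_sum (fun T HT => symeq_scale _ (step_symeq Mk ek HT)))).
apply: eq_symeq => w; rewrite sum_subset_setU1 //; apply: eq_bigr => T HT.
rewrite mulrBr cardsU1 (_ : e \notin T) /=; last by apply: contra eN; apply: subsetP.
by rewrite exprS !mulNr mul1r.
Qed.

Lemma linked_above0 w : linked_above 0 w = arc_const D w.
Proof.
apply/linked_aboveP/arc_constP => [H|H y /comp_prevP[_ Ry _] _]; last exact: H.
(* Descend from [y] through predecessors until [x] is met; [m] bounds [y] for the induction. *)
have Hlt m (x y : 'I_n) : (y < m)%N -> (x < y)%N -> comp_rel D x y -> w x = w y.
  elim: m x y => // m IH x y ym xy Rxy.
  have My : nonmin D y by apply/existsP; exists x; rewrite xy.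
  have [py Rpy Hp] := comp_prevP My; rewrite -(H y) //.
  have := Hp _ xy Rxy; rewrite leq_eqVlt => /orP[/eqP/ord_inj->//|xp].
  apply: (IH x) xp _; first by apply: leq_trans py _; rewrite -ltnS.
  by rewrite (comp_congr _ Rxy) comp_sym.
move=> x y Rxy; case: (ltngtP x y) => [xy|xy|/ord_inj->//].
  exact: Hlt (ltnSn _) xy Rxy.
by apply/esym/(Hlt _ _ _ (ltnSn _) xy); rewrite comp_sym.
Qed.

Lemma hybrid0 w : hybrid 0 w = (arc_const D w)%:R.
Proof.
have eA : arcs_below 0 = set0 by apply/setP => f; rewrite !inE andbF.
rewrite /hybrid eA (big_pred1 set0) => [|T]; last by rewrite subset0.
rewrite cards0 mul1r /coef big_pred0 => [|y]; last by rewrite andbF.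
by rewrite mul1r linked_above0 (_ : distinct_below _ _ _) //; apply/distinct_belowP.
Qed.

Lemma setpart_pieces T : setpart (pieces D T).
Proof.
have -> : pieces D T = equivalence_partition (fun x y => y \in piece D T x) setT.
  by apply/setP => A; apply/imsetP/imsetP => -[x _ ->]; exists x; rewrite ?inE //;
     apply/setP => y; rewrite !inE.
apply: equivalence_partitionP => x y z _ _ _; split; first exact: piece_refl.
by move=> xy; rewrite (piece_congr _ xy).
Qed.

Lemma pblock_pieces T x : pblock (pieces D T) x = piece D T x.
Proof.
apply: def_pblock; last exact: piece_refl.
  exact: partition_trivIset (setpart_pieces T).
exact: imset_f.
Qed.

Lemma e_basis_pieces T w : e_basis (pieces D T) w = (distinct_below n T w)%:R.
Proof.
congr (nat_of_bool _)%:R; apply: eq_forallb => x; apply: eq_forallb => y.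
rewrite !ltn_ord /= !pblock_pieces; congr (_ && _ ==> _).
apply/eqP/idP => [->|xy]; first exact: piece_refl.
by apply/setP => z; apply: piece_congr.
Qed.

Lemma symeq_arc_const (N : rel 'I_n) : (forall i j, N i j -> (i < j)%N) ->
  arc_diag N D ->
  symeq (fun w => (arc_const D w)%:R)
    (fun w => \sum_(T : {set 'I_n * 'I_n} | T \subset D)
       (-1) ^+ #|T| * (coef n T * e_basis (pieces D T) w)).
Proof.
move=> N_lt HD.
have Hk k : (k <= n)%N -> symeq (hybrid 0) (hybrid k).
  elim: k => [|k IH] kn; first exact: eq_symeq.
  apply: symeq_trans (IH (ltnW kn)) _.
  exact: (hybrid_step (Ordinal kn) N_lt HD).
apply: symeq_trans (symeq_trans (Hk n (leqnn n)) _).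
  by apply: eq_symeq => w; rewrite hybrid0.
apply: eq_symeq => w; rewrite /hybrid.
have -> : arcs_below n = D by apply/setP => f; rewrite inE ltn_ord andbT.
apply: eq_bigr => T _; rewrite e_basis_pieces (_ : linked_above n w) ?andbT //.
by apply/linked_aboveP => y _; rewrite leqNgt ltn_ord.
Qed.

End Pieces.

(** * Counting labelings and starrings *)

Section Counting.
Variables (n : nat) (D T : {set 'I_n * 'I_n}).

(** Only pairs whose larger vertex is at least [k] are constrained: [k = n] admits all permutations,
    [k = 0] exactly the increasing labelings. *)
Definition increasing_above (k : nat) (d : {perm 'I_n}) : bool :=
  [forall y : 'I_n, forall x : 'I_n,
     [&& (k <= y)%N, y \in piece D T x & (x < y)%N] ==> (d x < d y)%N].

Lemma increasing_aboveP k (d : {perm 'I_n}) :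
  reflect (forall y x : 'I_n, (k <= y)%N -> y \in piece D T x -> (x < y)%N -> (d x < d y)%N)
          (increasing_above k d).
Proof.
apply: (iffP forallP) => [H y x ky xy lt|H y].
  by have /forallP/(_ x) := H y; rewrite ky xy lt.
by apply/forallP => x; apply/implyP => /and3P[]; apply: H.
Qed.

Section IncreasingStep.
Variable k : 'I_n.
Let B := [set x in piece D T k | (x <= k)%N].
Let top (b : 'I_n) (d : {perm 'I_n}) : bool := [forall x in B, d x <= d b]%N.

Lemma increasing_above_top d :
  increasing_above k d = increasing_above k.+1 d && top k d.
Proof.
apply/increasing_aboveP/andP => [H|[/increasing_aboveP H /forall_inP Ht] y x].
  split; first by apply/increasing_aboveP => y x /ltnW; apply: H.
  apply/forall_inP => x; rewrite inE piece_sym => /andP[kx].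
  by rewrite leq_eqVlt => /orP[/eqP/ord_inj->//|xk]; apply/ltnW/H.
rewrite leq_eqVlt => /orP[/eqP/ord_inj<-|]; last exact: H.
move=> kx xk; rewrite ltn_neqAle Ht; last by rewrite inE piece_sym kx ltnW.
by rewrite andbT val_eqE (inj_eq perm_inj) -val_eqE /= neq_ltn xk.
Qed.

(* Composing with the transposition of [b] and [k] moves the largest label of [B] from
   [b] to [k]. *)
Lemma card_top b : b \in B ->
  #|[set d | increasing_above k.+1 d & top b d]| = #|[set d | increasing_above k d]|.
Proof.
move=> bB; have [bk lbk] : b \in piece D T k /\ (b <= k)%N by apply/andP; move: bB; rewrite inE.
pose s := tperm b k.
have s_piece x : s x \in piece D T x.
  by rewrite /s; case: tpermP => [->|->|_ _]; rewrite ?piece_refl // piece_sym.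
have s_gt (x : 'I_n) : (k < x)%N -> s x = x.
  move=> kx; rewrite /s tpermD // -val_eqE /= neq_ltn ?kx //.
  by rewrite (leq_ltn_trans lbk kx).
have s_lt (x y : 'I_n) : (k < y)%N -> (x < y)%N -> (s x < y)%N.
  move=> ky xy; rewrite /s; case: tpermP => // _; exact: leq_ltn_trans ky.
have s_inc d : increasing_above k.+1 d -> increasing_above k.+1 (s * d)%g.
  move=> /increasing_aboveP H; apply/increasing_aboveP => y x ky xy lt.
  rewrite !permM (s_gt y) //; apply: H => //; last exact: s_lt.
  by rewrite -(piece_congr _ (s_piece x)).
have sB x : x \in B -> s x \in B.
  rewrite !inE -!mem_piece => /andP[kx lx]; apply/andP; split.
    by rewrite piece_sym -(piece_congr _ (s_piece x)) piece_sym.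
  by rewrite /s; case: tpermP.
have s_top c d : top c d -> top (s c) (s * d)%g.
  move=> /forall_inP H; apply/forall_inP => x /sB xB.
  by rewrite !permM {2}/s tpermK H.
rewrite -(card_imset _ (mulgI s)); apply: eq_card => d; rewrite inE increasing_above_top.
apply/imsetP/andP => [[d']|[Hi Ht]]; first rewrite inE => /andP[Hi Ht] ->.
  by split; [apply: s_inc | have := s_top _ _ Ht; rewrite {1}/s tpermL].
exists (s * d)%g; last by rewrite mulgA tperm2 mul1g.
by rewrite inE s_inc //; have := s_top _ _ Ht; rewrite {1}/s tpermR.
Qed.

(** The largest label on [B] sits at exactly one vertex of [B], and by [card_top] each vertex is
    equally often that one. *)
Lemma card_increasing_aboveS :
  #|[set d | increasing_above k.+1 d]| =
  (height D T k * #|[set d | increasing_above k d]|)%N.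
Proof.
have kB : k \in B by rewrite inE piece_refl leqnn.
rewrite /height -/B -sum_nat_const -(eq_bigr _ card_top).
transitivity (\sum_(d | increasing_above k.+1 d) \sum_(b in B) top b d)%N; last first.
  rewrite exchange_big; apply: eq_bigr => b _; rewrite -sum1_card -big_mkcondr /=.
  by apply: eq_bigl => d; rewrite inE.
rewrite -sum1_card (eq_bigl (increasing_above k.+1)) => [|d]; last by rewrite inE.
apply: eq_bigr => d _.
case: (arg_maxnP (fun b => val (d b)) kB) => b bB maxb.
have tb : top b d by apply/forall_inP => x /maxb.
rewrite (bigD1 b) //= tb big1 // => c /andP[cB ncb].
case tc: (top c d) => //; case/eqP: ncb; apply: (@perm_inj _ d); apply: ord_inj.
by apply/eqP; rewrite eqn_leq (forall_inP tc) // (forall_inP tb).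
Qed.

End IncreasingStep.

(** The ranks in a piece of size m multiply to m!, so this is a multinomial count, obtained by
    telescoping over [k]. *)
Lemma card_increasing :
  (#|[set d | increasing_above 0 d]| * \prod_z height D T z)%N = n`!.
Proof.
have H k : (k <= n)%N -> #|[set d | increasing_above k d]| =
    (#|[set d | increasing_above 0 d]| * \prod_(z : 'I_n | (z < k)%N) height D T z)%N.
  elim: k => [|k IH] kn; first by rewrite big_pred0 ?muln1.
  rewrite (card_increasing_aboveS (Ordinal kn)) IH ?(ltnW kn) //=.
  rewrite [in RHS](bigD1 (Ordinal kn)) //= mulnCA; congr (_ * (_ * _))%N.
  by apply: eq_bigl => z; rewrite -val_eqE /= ltnS ltn_neqAle andbC.
rewrite (eq_bigl (fun z : 'I_n => (z < n)%N)) => [|z]; last by rewrite ltn_ord.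
rewrite -H //.
rewrite -card_Sn; apply: eq_card => d; rewrite !inE.
by apply/increasing_aboveP => y x; rewrite leqNgt ltn_ord.
Qed.

(** * Starrings *)

Definition comp_max (z : 'I_n) : bool := ~~ [exists y : 'I_n, (z < y)%N && comp_rel D z y].

Lemma comp_maxP z : reflect (forall y, comp_rel D z y -> (y <= z)%N) (comp_max z).
Proof.
apply: (iffP existsPn) => H y; first by move=> Ry; have := H y; rewrite Ry andbT -leqNgt.
by case Ry: (comp_rel D z y); rewrite ?andbF // andbT -leqNgt H.
Qed.

Lemma comp_max_exists x : exists2 z, comp_max z & comp_rel D x z.
Proof.
case: (arg_maxnP (@nat_of_ord n) (comp_refl D x)) => z Rxz Hz.
by exists z => //; apply/comp_maxP => y Rzy; apply: Hz; apply: comp_trans Rzy.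
Qed.

Lemma comp_max_uniq z z' : comp_max z -> comp_max z' -> comp_rel D z z' -> z = z'.
Proof.
move=> /comp_maxP Hz /comp_maxP Hz' R; apply: ord_inj; apply/eqP.
by rewrite eqn_leq Hz // Hz' // comp_sym.
Qed.

Lemma rm_pieceE x z : comp_max z -> comp_rel D x z -> rm_piece D T x = piece D T z.
Proof.
move=> Mz Rxz; apply/setP => y; rewrite [LHS]inE; apply/existsP/idP => [[z' /and3P[Rxz' Hz' yz']]|yz].
  suff -> : z = z' by [].
  apply: comp_max_uniq => //; last by rewrite -(comp_congr _ Rxz).
  apply/comp_maxP => u Ru; have /forallP/(_ u) := Hz'; rewrite (comp_trans Rxz' Ru).
  exact.
exists z; rewrite Rxz yz andbT /=; apply/forallP => u; apply/implyP => Rxu.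
by apply: (comp_maxP z Mz); rewrite -(comp_congr _ Rxz).
Qed.

Lemma height_max z : comp_max z -> height D T z = #|piece D T z|.
Proof.
move=> /comp_maxP Hz; apply: eq_card => x; rewrite inE mem_piece.
by case Rx: (comp_rel D z x); rewrite //= Hz ?andbT.
Qed.

Definition starring (S : {set 'I_n}) : bool :=
  [forall x : 'I_n, #|S :&: rm_piece D T x| == 1%N] &&
  [forall y in S, y \in rm_piece D T y].

(** A starring amounts to choosing, for each component maximum [z], a vertex of its piece; the size
    of that piece is the height of [z]. *)
Lemma card_starring : #|[set S | starring S]| = (\prod_(z | comp_max z) height D T z)%N.
Proof.
(* Away from the component maxima the value is forced to be [z], so that [f] is determined by its
   starring and these vertices contribute a factor 1. *)
pose F z : pred 'I_n := if comp_max z then [in piece D T z] else pred1 z.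
pose stars (f : {ffun 'I_n -> 'I_n}) := f @: [set z | comp_max z].
have FP f z : f \in family F -> comp_max z -> f z \in piece D T z.
  by move=> /familyP/(_ z); rewrite /F => + Mz; rewrite Mz.
have stars_piece f z : f \in family F -> comp_max z -> stars f :&: piece D T z = [set f z].
  move=> Ff Mz; apply/setP => y; rewrite in_setI in_set1.
  apply/andP/eqP => [[/imsetP[z' + ->] yz]|->]; last first.
    by rewrite FP //; split=> //; apply: imset_f; rewrite inE.
  rewrite inE => Mz'; congr (f _); apply: comp_max_uniq => //.
  have := FP _ _ Ff Mz'; rewrite piece_sym -(piece_congr _ yz).
  by rewrite mem_piece comp_sym => /andP[].
transitivity #|stars @: [set f in family F]|.
  apply: eq_card => S; rewrite inE; apply/andP/imsetP => [[/forallP H1 /forall_inP H2]|[f]].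
    have S1 z : comp_max z -> exists s, S :&: piece D T z = [set s].
      by move=> Mz; apply/cards1P; rewrite -(rm_pieceE Mz (comp_refl D z)).
    pose f := [ffun z => if comp_max z then odflt z [pick y in S :&: piece D T z] else z].
    have fE z s : comp_max z -> S :&: piece D T z = [set s] -> f z = s.
      move=> Mz Ss; rewrite ffunE Mz Ss; case: pickP => [y|/(_ s)]; rewrite inE.
        by move/eqP.
      by rewrite eqxx.
    have fS z : comp_max z -> f z \in S :&: piece D T z.
      by move=> Mz; have [s Ss] := S1 z Mz; rewrite (fE _ _ Mz Ss) Ss inE.
    exists f.
      rewrite inE; apply/familyP => z; rewrite /F.
      case Mz: (comp_max z); last by rewrite unfold_in /= ffunE Mz.
      by have := fS z Mz; rewrite inE => /andP[].
    apply/setP => y; apply/idP/imsetP => [yS|[z]]; last first.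
      by rewrite inE => /fS; rewrite inE => /andP[zS _] ->.
    have [z Mz Ryz] := comp_max_exists y; exists z; first by rewrite inE.
    have [s Ss] := S1 z Mz; rewrite (fE _ _ Mz Ss); apply/eqP; rewrite -in_set1 -Ss.
    by rewrite inE yS -(rm_pieceE Mz Ryz) H2.
  rewrite inE => Ff ->; split.
    apply/forallP => x; have [z Mz Rxz] := comp_max_exists x.
    by rewrite (rm_pieceE Mz Rxz) stars_piece // cards1.
  apply/forall_inP => y /imsetP[z + ->]; rewrite inE => Mz.
  have := FP _ _ Ff Mz => fz; rewrite (@rm_pieceE _ z) //.
  by move: fz; rewrite mem_piece comp_sym => /andP[].
rewrite card_in_imset => [|f g]; last first.
  rewrite !inE => Ff Fg fg; apply/ffunP => z; case Mz: (comp_max z).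
    by apply/set1_inj; rewrite -!stars_piece // fg.
  have := familyP Ff z; have := familyP Fg z; rewrite /F Mz !unfold_in /=.
  by move=> /eqP-> /eqP->.
rewrite cardsE card_family foldrE big_image /= [RHS]big_mkcond /=.
apply: eq_bigr => z _; rewrite /F; case Mz: (comp_max z); last by rewrite card1.
by rewrite height_max.
Qed.

(** If [y < y'] shared a predecessor, [y] itself would be a later candidate for the predecessor of
    [y']. *)
Lemma comp_prev_inj : {in nonmin D &, injective (comp_prev D)}.
Proof.
have lt_neq y y' : nonmin D y -> nonmin D y' -> comp_prev D y = comp_prev D y' ->
    (y < y')%N -> false.
  move=> /comp_prevP[py Ry _] /comp_prevP[_ Ry' H] e lt.
  have := H y lt; rewrite -e leqNgt py; apply.
  by rewrite -(comp_congr _ Ry) e.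
move=> y y' My My' e; case: (ltngtP y y') => [lt|lt|/ord_inj//].
  by have := lt_neq _ _ My My' e lt.
by have := lt_neq _ _ My' My (esym e) lt.
Qed.

Lemma prod_height_prev :
  (\prod_(y | nonmin D y) height D T (comp_prev D y) =
   \prod_(z | ~~ comp_max z) height D T z)%N.
Proof.
rewrite -(big_imset _ comp_prev_inj) /=; apply: eq_bigl => z; rewrite negbK.
apply/imsetP/existsP => [[y My ->]|[y0 Hy0]].
  have [py Ry _] := comp_prevP My; exists y; by rewrite py.
pose P (y : 'I_n) := (z < y)%N && comp_rel D z y.
(* The preimage of [z] is the next vertex of its component. *)
case: (arg_minnP (@nat_of_ord n) (Hy0 : P y0)) => y /andP[zy Rzy] miny.
have My : nonmin D y by apply/existsP; exists z; rewrite zy.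
exists y => //; have [py Ry Hy] := comp_prevP My.
apply: ord_inj; apply/eqP; rewrite eqn_leq Hy //= leqNgt; apply/negP => lt.
have /miny : P (comp_prev D y) by rewrite /P lt (comp_congr _ Rzy) comp_sym.
by rewrite leqNgt py.
Qed.

(** Dividing by n! leaves the inverse heights of all vertices; starrings cancel those of the
    component maxima, and the other vertices are the predecessors. *)
Lemma card_labelings :
  (#|[set d | increasing_above 0 d]| * #|[set S | starring S]|)%:R / (n`!)%:R =
  (-1) ^+ #|[set y | nonmin D y]| * coef D n T :> rat.
Proof.
have h0 z : (height D T z)%:R != 0 :> rat by rewrite Num.Theory.pnatr_eq0 -lt0n height_gt0.
have -> : coef D n T = \prod_(y in [set y | nonmin D y]) - (height D T (comp_prev D y))%:R^-1.
  by apply: eq_bigl => y; rewrite inE ltn_ord andbT.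
rewrite prodrN mulrA -exprMn_comm ?mulrNN ?mulr1 ?expr1n ?mul1r; last exact: mulrC.
rewrite prodfV -natr_prod (eq_bigl (nonmin D)) => [|y]; last by rewrite inE.
rewrite prod_height_prev -card_increasing card_starring.
rewrite [X in _ / (_ * X)%:R](bigID comp_max) /=.
have p0 (P : pred 'I_n) : (\prod_(z | P z) height D T z)%:R != 0 :> rat.
  by rewrite natr_prod; apply/prodf_neq0.
have c0 : (#|[set d | increasing_above 0 d]|)%:R != 0 :> rat.
  rewrite Num.Theory.pnatr_eq0; apply/eqP => c0.
  by have := fact_gt0 n; rewrite -card_increasing c0.
rewrite mulnA !natrM invfM mulrA divff ?mul1r //.
by rewrite mulf_neq0.
Qed.

End Counting.

(** * The e-basis *)

Section Bases.
Variable n : nat.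
Implicit Types (P Q : {set {set 'I_n}}) (w : 'I_n -> nat) (D : {set 'I_n * 'I_n}).

(** The equivalence relation as a set of pairs: refinement becomes inclusion, and cardinality serves
    as induction measure. *)
Definition kernel P : {set 'I_n * 'I_n} := [set u | pblock P u.1 == pblock P u.2].

Definition p_basis P : series n := fun w =>
  ([forall u in kernel P, w u.1 == w u.2] : bool)%:R.

Lemma mem_pblock_kernel P x y : setpart P -> (y \in pblock P x) = ((x, y) \in kernel P).
Proof.
move=> HP; rewrite inE /= -eq_pblock ?(partition_trivIset HP) //.
by rewrite (cover_partition HP) inE.
Qed.

Lemma kernel_inj : {in @setpart n &, injective kernel}.
Proof.
move=> P Q HP HQ e.
rewrite -(equivalence_partition_pblock HP) -(equivalence_partition_pblock HQ).
by apply: eq_imset => x; apply/setP => y; rewrite !inE !mem_pblock_kernel // e.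
Qed.

(** A test word whose letters agree exactly within blocks: each block is numbered by its rank among
    all subsets. *)
Definition block_word P (x : 'I_n) : nat := enum_rank (pblock P x).

Lemma p_basis_block_word P Q : p_basis P (block_word Q) = (kernel P \subset kernel Q)%:R.
Proof.
congr (nat_of_bool _)%:R; apply/forall_inP/subsetP => H u /H.
  by rewrite inE => /eqP/ord_inj/enum_rank_inj->.
by rewrite inE => /eqP e; rewrite /block_word e.
Qed.

Definition comps D : {set {set 'I_n}} := equivalence_partition (comp_rel D) setT.

Lemma comp_equiv D : {in [set: 'I_n] & &, equivalence_rel (comp_rel D)}.
Proof.
move=> x y z _ _ _; split; first exact: comp_refl.
exact: comp_congr.
Qed.

Lemma setpart_comps D : setpart (comps D).
Proof. exact: equivalence_partitionP (@comp_equiv D). Qed.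

Lemma mem_kernel_comps D x y : ((x, y) \in kernel (comps D)) = comp_rel D x y.
Proof.
rewrite -mem_pblock_kernel ?setpart_comps //.
by rewrite (pblock_equivalence_partition (@comp_equiv D)) ?inE.
Qed.

Lemma p_basis_comps D w : p_basis (comps D) w = (arc_const D w)%:R.
Proof.
congr (nat_of_bool _)%:R; apply/forall_inP/arc_constP => [H x y Rxy|H [x y]].
  by apply/eqP/(H (x, y)); rewrite mem_kernel_comps.
by rewrite mem_kernel_comps => /H ->.
Qed.

(** The disjoint union of complete graphs on the blocks, edges directed upwards. The e-function of
    [P] records its proper colorings, so [arc_expansion] applies. *)
Definition block_lt P : rel 'I_n := fun i j => (i < j)%N && ((i, j) \in kernel P).

Lemma block_lt_lt P i j : block_lt P i j -> (i < j)%N.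
Proof. by case/andP. Qed.

Lemma block_lt_interval P i i' j :
  block_lt P i j -> block_lt P i' j -> (i < i')%N -> block_lt P i i'.
Proof.
rewrite /block_lt !inE /= => /andP[_ /eqP->] /andP[_ /eqP->] ->.
exact: eqxx.
Qed.

(** For set partitions with [P] refining [Q], this is the Möbius function of the partition lattice
    between the finest partition and [P]. *)
Definition e_to_p Q P : rat :=
  \sum_(D | arc_diag (block_lt Q) D && (comps D == P)) (-1) ^+ #|D|.

Lemma e_basis_p Q w :
  e_basis Q w = \sum_(P | setpart P) e_to_p Q P * p_basis P w.
Proof.
transitivity (([forall i, forall j, block_lt Q i j ==> (w i != w j)] : bool)%:R : rat).
  congr (nat_of_bool _)%:R; apply/forallP/forallP => H i; apply/forallP => j;
    apply/implyP.
    rewrite /block_lt inE => /andP[ij e]; have /forallP/(_ j) := H i.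
    by rewrite e -val_eqE /= neq_ltn ij.
  case/andP; rewrite -val_eqE /= neq_ltn => /orP[ij|ij] e.
    by have /forallP/(_ j) := H i; rewrite /block_lt inE e ij.
  have /forallP/(_ i) := H j.
  by rewrite /block_lt inE /= eq_sym e ij eq_sym.
rewrite (arc_expansion _ (@block_lt_lt Q) (@block_lt_interval Q)).
rewrite (partition_big comps (@setpart n)) /= => [|D _]; last exact: setpart_comps.
apply: eq_bigr => P _; rewrite mulr_suml; apply: eq_bigr => D /andP[_ /eqP <-].
by rewrite p_basis_comps.
Qed.

Lemma kernel_comps_sub Q D : arc_diag (block_lt Q) D -> kernel (comps D) \subset kernel Q.
Proof.
move=> /arc_diagP[HD _]; apply/subsetP => -[x y]; rewrite mem_kernel_comps.
have HQ (u : 'I_n) v : (u, v) \in D -> pblock Q u = pblock Q v.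
  by move=> /HD /andP[_]; rewrite inE => /eqP.
rewrite inE /= => /connectP[p + ->].
elim: p x => [|z p IH] x //= /andP[/orP xz /IH /eqP <-].
by case: xz => /HQ ->.
Qed.

Lemma e_to_p_kernel Q P : e_to_p Q P != 0 -> kernel P \subset kernel Q.
Proof.
apply: contraNT => sPQ; rewrite /e_to_p big_pred0 // => D.
by apply/negP => /andP[/kernel_comps_sub sD /eqP eP]; rewrite -eP sD in sPQ.
Qed.

(* All arc diagrams with components the blocks of [P] have the same sign, and joining
   every vertex to the minimum of its block is one of them. *)
Lemma e_to_p_diag P : setpart P -> e_to_p P P != 0.
Proof.
move=> HP; pose c := #|[set y : 'I_n | [exists x, block_lt P x y]]|.
have -> : e_to_p P P =
    (-1) ^+ c * #|[set D | arc_diag (block_lt P) D && (comps D == P)]|%:R.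
  rewrite mulr_natr -sumr_const; apply: eq_big => [D|D]; first by rewrite inE.
  case/andP=> HD /eqP eD; congr (_ ^+ _).
  rewrite (card_arc_diag (@block_lt_lt P) HD); apply: eq_card => y; rewrite !inE.
  by apply: eq_existsb => x; rewrite /block_lt -eD mem_kernel_comps.
rewrite mulf_neq0 ?signr_eq0 // Num.Theory.pnatr_eq0 -lt0n; apply/card_gt0P.
pose D := [set u : 'I_n * 'I_n | block_lt P u.1 u.2 &&
  [forall z : 'I_n, ((z, u.2) \in kernel P) ==> (u.1 <= z)%N]].
have D_lt i j : (i, j) \in D -> block_lt P i j by rewrite inE => /andP[].
have HD : arc_diag (block_lt P) D.
  apply/arc_diagP; split=> // i i' j.
  rewrite !inE /= => /andP[/andP[_ ij] /forallP Hi] /andP[/andP[_ ij'] /forallP Hi'].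
  apply/ord_inj/eqP; rewrite eqn_leq.
  by rewrite (implyP (Hi i')) // (implyP (Hi' i)).
exists D; rewrite inE HD /=; apply/eqP/kernel_inj => //; first exact: setpart_comps.
apply/eqP; rewrite eqEsubset kernel_comps_sub //=.
apply/subsetP => -[x y] Kxy; rewrite mem_kernel_comps.
pose M (z : 'I_n) := (z, y) \in kernel P.
have [m Mm minm] : exists2 m, M m & forall z, M z -> (m <= z)%N.
  by case: (arg_minnP (@nat_of_ord n) (Kxy : M x)) => m; exists m.
have mR z : M z -> comp_rel D m z.
  move=> Mz; have := minm _ Mz; rewrite leq_eqVlt => /orP[/eqP/ord_inj->|lt].
    exact: comp_refl.
  apply: comp_arc; move: Mm Mz; rewrite /M !inE /= => /eqP em /eqP ez.
  rewrite /block_lt lt inE /= em ez eqxx /=; apply/forallP => u; apply/implyP.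
  by rewrite inE /= => eu; apply: minm; rewrite /M inE /= (eqP eu) ez.
rewrite -(comp_congr _ (mR _ Kxy)); apply: mR.
by rewrite /M inE.
Qed.

(** * Existence and uniqueness of e-coefficients *)

Lemma ecoeffs_ext (f g : series n) a : f =1 g -> ecoeffs f a -> ecoeffs g a.
Proof. by move=> fg Hf w; rewrite -fg Hf. Qed.

Lemma ecoeffs_e_basis Q : setpart Q -> ecoeffs (e_basis Q) (fun P => (P == Q)%:R).
Proof.
move=> HQ w; rewrite (bigD1 Q) //= eqxx mul1r big1 ?addr0 // => P /andP[_ /negPf->].
by rewrite mul0r.
Qed.

Lemma ecoeffs_sum (I : finType) (A : pred I) (c : I -> rat) (f : I -> series n) :
  (forall i, A i -> exists a, ecoeffs (f i) a) ->
  exists a, ecoeffs (fun w => \sum_(i | A i) c i * f i w) a.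
Proof.
move=> Hf; have /fin_all_exists[a Ha] : forall i, exists a, A i -> ecoeffs (f i) a.
  move=> i; case Ai: (A i); last by exists (fun=> 0).
  by have [a Ha] := Hf i Ai; exists a.
exists (fun P => \sum_(i | A i) c i * a i P) => w.
under [RHS]eq_bigr do rewrite mulr_suml.
rewrite [RHS]exchange_big /=; apply: eq_bigr => i Ai.
by rewrite (Ha i Ai) mulr_sumr; apply: eq_bigr => P _; rewrite mulrA.
Qed.

(** The expansion of [e_basis P] has a nonzero multiple of [p_basis P] and otherwise strictly finer
    partitions; solve for [p_basis P] by induction on the kernel. *)
Lemma ecoeffs_p_basis P : setpart P -> exists a, ecoeffs (p_basis P) a.
Proof.
have [m] := ubnP #|kernel P|; elim: m P => // m IH P; rewrite ltnS => lem HP.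
pose A Q := [&& setpart Q, Q != P & e_to_p P Q != 0].
have HA Q : A Q -> exists a, ecoeffs (p_basis Q) a.
  case/and3P=> HQ nQP /e_to_p_kernel sQP; apply: IH => //.
  apply: leq_trans (proper_card _) lem.
  by rewrite properEneq sQP andbT; apply: contra nQP => /eqP/kernel_inj->.
have [b Hb] := ecoeffs_sum (e_to_p P) HA.
pose c := (e_to_p P P)^-1.
exists (fun Q => c * ((Q == P)%:R - b Q)) => w.
under eq_bigr do rewrite -mulrA mulrBl mulrBr.
rewrite sumrB -!mulr_sumr -ecoeffs_e_basis // -Hb -mulrBr.
rewrite e_basis_p (bigD1 P) //= [X in _ + X - _](bigID (fun Q => e_to_p P Q != 0)) /=.
rewrite [X in _ + (_ + X) - _]big1 ?addr0 => [|Q /andP[_]]; last first.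
  by rewrite negbK => /eqP->; rewrite mul0r.
rewrite (eq_bigl A) => [|Q]; last by rewrite /A andbA.
by rewrite addrK mulKf ?e_to_p_diag.
Qed.

(** Evaluating at [block_word Q] keeps only the partitions refining [Q], and the strictly finer ones
    are settled by induction. *)
Lemma p_basis_free (b : {set {set 'I_n}} -> rat) :
  (forall w, \sum_(P | setpart P) b P * p_basis P w = 0) ->
  forall P, setpart P -> b P = 0.
Proof.
move=> Hb P; have [m] := ubnP #|kernel P|; elim: m P => // m IH Q; rewrite ltnS => lem HQ.
have := Hb (block_word Q); rewrite (bigD1 Q) //= p_basis_block_word subxx mulr1.
rewrite big1 ?addr0 // => P /andP[HP nPQ]; rewrite p_basis_block_word.
case sPQ: (kernel P \subset kernel Q); last by rewrite mulr0.
rewrite IH ?mul0r //; apply: leq_trans (proper_card _) lem.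
by rewrite properEneq sPQ andbT; apply: contra nPQ => /eqP/kernel_inj->.
Qed.

Lemma e_basis_free (a : {set {set 'I_n}} -> rat) :
  (forall w, \sum_(P | setpart P) a P * e_basis P w = 0) ->
  forall P, setpart P -> a P = 0.
Proof.
move=> Ha; pose b P := \sum_(Q | setpart Q) a Q * e_to_p Q P.
have Hb P : setpart P -> b P = 0.
  apply: p_basis_free => w; rewrite -[RHS](Ha w) /b.
  under eq_bigr do rewrite mulr_suml.
  rewrite exchange_big /=; apply: eq_bigr => Q _; rewrite e_basis_p mulr_sumr.
  by apply: eq_bigr => R _; rewrite mulrA.
(* Here coarser partitions contribute to the coefficient at [P], so the induction runs from coarse
   to fine, on the complement of the kernel. *)
move=> P; have [m] := ubnP #|~: kernel P|; elim: m P => // m IH P; rewrite ltnS => lem HP.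
have := Hb P HP; rewrite /b (bigD1 P) //= big1 ?addr0 => [/eqP|Q /andP[HQ nQP]].
  by rewrite mulf_eq0 (negPf (e_to_p_diag HP)) orbF => /eqP.
have [->|/e_to_p_kernel sPQ] := eqVneq (e_to_p Q P) 0; first by rewrite mulr0.
rewrite IH ?mul0r //; apply: leq_trans (proper_card _) lem.
by rewrite properEneq setCS sPQ andbT; apply: contra nQP => /eqP/setC_inj/kernel_inj->.
Qed.

(** * Permuting positions *)

Definition perm_part (s : {perm 'I_n}) P : {set {set 'I_n}} :=
  (fun B : {set 'I_n} => s @: B) @: P.

Lemma perm_imset_inj (s : {perm 'I_n}) : injective (fun B : {set 'I_n} => s @: B).
Proof. exact/imset_inj/perm_inj. Qed.

Lemma perm_part_inj s : injective (perm_part s).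
Proof. exact/imset_inj/perm_imset_inj. Qed.

Lemma perm_partK s : cancel (perm_part s) (perm_part s^-1).
Proof.
move=> P; rewrite /perm_part -imset_comp -[RHS]imset_id; apply: eq_imset => B /=.
by rewrite -imset_comp -[RHS]imset_id; apply: eq_imset => x /=; rewrite permK.
Qed.

Lemma setpart_perm s P : setpart (perm_part s P) = setpart P.
Proof.
rewrite /setpart /perm_part.
have {1}-> : [set: 'I_n] = s @: [set: 'I_n].
  by apply/setP => x; rewrite -[x](permKV s) (mem_imset _ _ perm_inj) !inE.
by rewrite imset_partition; first by []; apply: perm_inj.
Qed.

Lemma pblock_perm (s : {perm 'I_n}) P x : setpart P -> pblock (perm_part s P) (s x) = s @: pblock P x.
Proof.
move=> HP; apply: def_pblock.
- by apply: (@partition_trivIset _ _ setT); rewrite -/(setpart _) setpart_perm.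
- by apply: imset_f; rewrite pblock_mem // (cover_partition HP).
- by rewrite imset_f // mem_pblock (cover_partition HP).
Qed.

Lemma e_basis_perm (s : {perm 'I_n}) P w : setpart P ->
  e_basis P (fun x => w (s x)) = e_basis (perm_part s P) w.
Proof.
move=> HP; congr (nat_of_bool _)%:R.
have H j k : (pblock (perm_part s P) (s j) == pblock (perm_part s P) (s k)) =
    (pblock P j == pblock P k).
  by rewrite !pblock_perm // (inj_eq (@perm_imset_inj s)).
apply/forallP/forallP => E j; apply/forallP => k; last first.
  by have /forallP/(_ (s k)) := E (s j); rewrite H (inj_eq perm_inj).
have /forallP/(_ (s^-1%g k)) := E (s^-1%g j).
by rewrite -H !permKV (inj_eq perm_inj).
Qed.

Lemma part_equiv_perm s P Q : fixes_last s ->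
  part_equiv (perm_part s P) Q = part_equiv P Q.
Proof.
move=> /forallP Hs; rewrite /part_equiv; congr (_ && _).
  have eP : perm_eq (enum (perm_part s P)) (map (fun B : {set 'I_n} => s @: B) (enum P)).
    apply: uniq_perm; first exact: enum_uniq.
      by rewrite map_inj_uniq ?enum_uniq //; apply: perm_imset_inj.
    move=> B; rewrite mem_enum; apply/imsetP/mapP => -[C HC ->]; exists C => //.
      by rewrite mem_enum.
    by rewrite -mem_enum.
  rewrite (permPl (perm_map _ eP)) -map_comp.
  congr (perm_eq _ _); apply: eq_map => B /=.
  by rewrite card_imset //; apply: perm_inj.
congr (_ == _); rewrite /blk_last big_mkcondr [RHS]big_mkcondr big_imset /=; last first.
  by move=> B C _ _; apply: perm_imset_inj.
apply: eq_bigr => B _; rewrite card_imset; last exact: perm_inj.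
congr (if _ then _ else _).
have fixl (x : 'I_n) : val x == n.-1 -> s x = x by move=> xn; apply/eqP/(implyP (Hs x)).
apply/exists_inP/exists_inP => [[x /imsetP[y yB exy] xn]|[x xB xn]].
  by exists y => //; have <- : x = y by apply: (@perm_inj _ s); rewrite -exy fixl.
by exists x => //; rewrite -(fixl x xn) imset_f.
Qed.

(** By freeness the symmetrised coefficients of [f] and [g] agree. Equivalence classes are stable
    under the permutations, so symmetrising multiplies each class sum by the same nonzero number. *)
Lemma symeq_part_equiv (f g : series n) a b : symeq f g -> ecoeffs f a -> ecoeffs g b ->
  forall P0, \sum_(Q | setpart Q && part_equiv Q P0) a Q =
             \sum_(Q | setpart Q && part_equiv Q P0) b Q.
Proof.
move=> fg Ha Hb P0.
pose sym (c : {set {set 'I_n}} -> rat) P := \sum_(s | fixes_last s) c (perm_part s^-1%g P).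
have sym_e h c : ecoeffs h c -> forall w,
    \sum_(s | fixes_last s) h (fun x => w (s x)) = \sum_(P | setpart P) sym c P * e_basis P w.
  move=> Hc w; under [RHS]eq_bigr do rewrite mulr_suml.
  rewrite [RHS]exchange_big /=; apply: eq_bigr => s _; rewrite Hc.
  rewrite [RHS](reindex_inj (@perm_part_inj s)) /=; apply: eq_big => P.
    by rewrite setpart_perm.
  by move=> HP; rewrite perm_partK e_basis_perm.
have symab P : setpart P -> sym a P = sym b P.
  move=> HP; apply/eqP; rewrite -subr_eq0; apply/eqP; move: P HP.
  apply: (@e_basis_free (fun P => sym a P - sym b P)) => w.
  under eq_bigr do rewrite mulrBl.
  by rewrite sumrB -(sym_e f a Ha) -(sym_e g b Hb) fg subrr.
pose N := \sum_(s : {perm 'I_n} | fixes_last s) (1 : rat).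
have N0 : N != 0.
  rewrite /N sumr_const Num.Theory.pnatr_eq0 -lt0n; apply/card_gt0P; exists 1%g.
  by apply/forallP => x; rewrite perm1 eqxx implybT.
have symN c : \sum_(P | setpart P && part_equiv P P0) sym c P =
    N * \sum_(Q | setpart Q && part_equiv Q P0) c Q.
  rewrite exchange_big mulr_suml; apply: eq_bigr => s Hs /=; rewrite mul1r.
  rewrite (reindex_inj (@perm_part_inj s)) /=; apply: eq_big => P.
    by rewrite setpart_perm part_equiv_perm.
  by rewrite perm_partK.
apply: (mulfI N0); rewrite -!symN; apply: eq_bigr => P /andP[HP _]; exact: symab.
Qed.

End Bases.

(** * Unit interval graphs *)

Definition interval_arc (n : nat) (a : 'I_n -> nat) : rel 'I_n :=
  fun i j => (i < j)%N && in_common_interval a i j.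

Lemma interval_arc_lt (n : nat) (a : 'I_n -> nat) i j : interval_arc a i j -> (i < j)%N.
Proof. by case/andP. Qed.

(** An interval containing [i] and [j] also contains [i'], which lies between them. *)
Lemma interval_arc_interval (n : nat) (a : 'I_n -> nat) i i' j :
  interval_arc a i j -> interval_arc a i' j -> (i < i')%N -> interval_arc a i i'.
Proof.
move=> /andP[_ /existsP[k /and4P[ai ik aj jk]]] /andP[i'j _] ii'.
rewrite /interval_arc ii' /=; apply/existsP; exists k.
by rewrite ai ik (leq_trans ai (ltnW ii')) (leq_trans (ltnW i'j) jk).
Qed.

Lemma Y_graph_arcs (n : nat) (a : 'I_n -> nat) w :
  Y_graph (uig_adj a) w =
  \sum_(D | arc_diag (interval_arc a) D) (-1) ^+ #|D| * (arc_const D w)%:R.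
Proof.
rewrite -(arc_expansion _ (@interval_arc_lt _ a) (@interval_arc_interval _ a)).
have sym i j : in_common_interval a i j = in_common_interval a j i.
  by apply: eq_existsb => k; rewrite andbA andbC -andbA.
congr (nat_of_bool _)%:R; apply/forallP/forallP => H i; apply/forallP => j; apply/implyP.
  move=> /andP[ij cij]; have /forallP/(_ j) := H i.
  by rewrite /uig_adj cij -val_eqE /= neq_ltn ij.
rewrite /uig_adj -val_eqE /= neq_ltn => /andP[/orP[ij|ij] cij].
  by have /forallP/(_ j) := H i; rewrite /interval_arc ij cij.
by have /forallP/(_ i) := H j; rewrite /interval_arc ij -sym cij eq_sym.
Qed.

Lemma AL_primeE (n : nat) (a : 'I_n -> nat) D T d S :
  AL_prime a D T d S =
  [&& arc_diag (interval_arc a) D, T \subset D, increasing_above D T 0 d & starring D T S].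
Proof.
rewrite /AL_prime; congr [&& _, _, _ & _].
apply/forallP/increasing_aboveP => [H y x _ xy lt|H x].
  by have /forallP/(_ y) := H x; rewrite xy lt.
by apply/forallP => y; apply/implyP => /andP[xy lt]; apply: H.
Qed.

(** For fixed [D] and [T] the summand depends on neither labels nor stars, so it is multiplied by
    the number of labelings times that of starrings. *)
Lemma AL_sum_arcs (n : nat) (a : 'I_n -> nat) w :
  AL_sum a w =
  \sum_(D | arc_diag (interval_arc a) D) (-1) ^+ #|D| *
    \sum_(T : {set 'I_n * 'I_n} | T \subset D)
       (-1) ^+ #|T| * (coef D n T * e_basis (pieces D T) w).
Proof.
rewrite /AL_sum mulr_sumr [RHS]big_mkcond /=; apply: eq_bigr => D _.
case HD: (arc_diag _ D); last first.
  rewrite big1 ?mulr0 // => T _; rewrite big1 // => d _; rewrite big_pred0 // => S.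
  by rewrite AL_primeE HD.
rewrite !mulr_sumr [RHS]big_mkcond /=; apply: eq_bigr => T _.
case HT: (T \subset D); last first.
  rewrite big1 ?mulr0 // => d _; rewrite big_pred0 // => S.
  by rewrite AL_primeE HT andbF.
set c := (-1) ^+ #|T| * e_basis _ _.
have -> : \sum_(d : {perm 'I_n}) \sum_(S | AL_prime a D T d S) c =
    (#|[set d | increasing_above D T 0 d]| * #|[set S | starring D T S]|)%:R * c.
  rewrite mulnC mulr_natl mulrnA -[RHS]sumr_const [RHS]big_mkcond.
  apply: eq_bigr => d _; rewrite inE -sumr_const.
  under eq_bigl do rewrite AL_primeE HD HT /=.
  case: (increasing_above _ _ _ _) => /=; last by rewrite big_pred0.
  by apply: eq_bigl => S; rewrite inE.
rewrite [LHS]mulrA [X in X * c]mulrC card_labelings -(card_arc_diag (@interval_arc_lt _ a) HD).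
by rewrite /c -!mulrA; congr (_ * _); rewrite mulrCA.
Qed.

Theorem mainTheorem7 (n : nat) (a : 'I_n -> nat) :
  unit_interval_seq a ->
  equiv_n (Y_graph (uig_adj a)) (AL_sum a).
Proof.
move=> _; split; [|split].
(* The chromatic series has e-coefficients because it is a combination of power sums. *)
- have HD D : arc_diag (interval_arc a) D ->
      exists c, ecoeffs (fun w => (arc_const D w)%:R) c.
    move=> _; have [c Hc] := ecoeffs_p_basis (setpart_comps D); exists c.
    by apply: ecoeffs_ext Hc => w; apply: p_basis_comps.
  have [c Hc] := ecoeffs_sum (fun D : {set 'I_n * 'I_n} => (-1) ^+ #|D|) HD; exists c.
  by apply: ecoeffs_ext Hc => w; rewrite Y_graph_arcs.
- have HD D : arc_diag (interval_arc a) D -> exists c,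
      ecoeffs (fun w => \sum_(T : {set 'I_n * 'I_n} | T \subset D)
       (-1) ^+ #|T| * (coef D n T * e_basis (pieces D T) w)) c.
    move=> _; have HT (T : {set 'I_n * 'I_n}) : T \subset D -> exists c, ecoeffs (e_basis (pieces D T)) c.
      by move=> _; eexists; apply/ecoeffs_e_basis/setpart_pieces.
    have [c Hc] := ecoeffs_sum (fun T : {set 'I_n * 'I_n} => (-1) ^+ #|T| * coef D n T) HT; exists c.
    by apply: ecoeffs_ext Hc => w; apply: eq_bigr => T _; rewrite mulrA.
  have [c Hc] := ecoeffs_sum (fun D : {set 'I_n * 'I_n} => (-1) ^+ #|D|) HD; exists c.
  by apply: ecoeffs_ext Hc => w; rewrite AL_sum_arcs.
move=> b c Hb Hc P0 _; apply: symeq_part_equiv Hb Hc P0.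
(* Both sides are now signed sums over the same diagrams, compared diagram by diagram. *)
apply: (symeq_trans (eq_symeq (Y_graph_arcs a))).
apply: symeq_trans (eq_symeq (fun w => esym (AL_sum_arcs a w))).
apply: symeq_sum => D HD; apply: symeq_scale.
exact: symeq_arc_const (@interval_arc_lt _ a) HD.
Qed.
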